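(* Let $k$ be a field of characteristic zero, let $(\mathcal{A},[\cdot,\cdot],\triangleright)$ be a post-Lie algebra over $k$, let $\mathfrak{g}=(\mathcal{A},[\cdot,\cdot])$, and let $\mathcal{U}(\mathfrak{g})$ be its universal enveloping algebra. There is a unique extension of the post-Lie product $\triangleright$ from $\mathfrak{g}$ to a bilinear product $\triangleright$ on $\mathcal{U}(\mathfrak{g})$ such that for all $A,B,C\in\mathcal{U}(\mathfrak{g})$ and $x,y\in\mathfrak{g}$: \begin{align*} &\mathbf{1}\triangleright A = A,\\ &(xA)\triangleright y = x\triangleright(A\triangleright y)-(x\triangleright A)\triangleright y,\\ &A\triangleright(BC) = (A_{(1)}\triangleright B)(A_{(2)}\triangleright C). \end{align*}
   Context: A post-Lie algebra $(\mathcal{A},[\cdot,\cdot],\triangleright)$ is a Lie algebra $\mathfrak{g}=(\mathcal{A},[\cdot,\cdot])$ together with a bilinear product $\triangleright:\mathcal{A}\times\mathcal{A}\to\mathcal{A}$ such that for all $x,y,z$: $x\triangleright[y,z]=[x\triangleright y,z]+[y,x\triangleright z]$ and $[x,y]\triangleright z=a_\triangleright(x,y,z)-a_\triangleright(y,x,z)$, where $a_\triangleright(x,y,z)=x\triangleright(y\triangleright z)-(x\triangleright y)\triangleright z$. $\mathcal{U}(\mathfrak{g})$ is the universal enveloping algebra with unit $\mathbf{1}$ and product written as concatenation. $\Delta:\mathcal{U}(\mathfrak{g})\to\mathcal{U}(\mathfrak{g})\otimes\mathcal{U}(\mathfrak{g})$ is the coshuffle coproduct: the algebra morphism with $\Delta(x)=x\otimes\mathbf{1}+\mathbf{1}\otimes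 x$ for $x\in\mathfrak{g}$. Sweedler notation $\Delta(A)=A_{(1)}\otimes A_{(2)}$ (summation implied) is used. *)

(* Defs.v *)
From HB Require Import structures.
From mathcomp Require Import all_boot all_order all_algebra.
From mathcomp Require Import boolp.

Set Implicit Arguments.
Unset Strict Implicit.
Unset Printing Implicit Defensive.

Import GRing.Theory.
Local Open Scope ring_scope.
Local Open Scope quotient_scope.

Lemma linear_morph (k : fieldType) (V X : lmodType k) (h : V -> X) :
  linear h ->
  [/\ h 0 = 0, forall u v, h (u + v) = h u + h v
    & forall c u, h (c *: u) = c *: h u].
Proof.
move=> hL; pose h' := GRing.isLinear.Build k V X _ h hL.
pose H : {linear V -> X} := HB.pack h h'.
split=> [|u v|c u]; [exact: (linear0 H) | exact: (linearD H)|].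
exact: (linearZ_LR H).
Qed.

HB.mixin Record Lmodule_isLie (k : fieldType) g of GRing.Lmodule k g := {
  lie : g -> g -> g;
  lie_linearl : forall y, linear (lie^~ y);
  lie_linearr : forall x, linear (lie x);
  liexx : forall x, lie x x = 0;
  lie_jacobi : forall x y z,
    lie x (lie y z) + lie y (lie z x) + lie z (lie x y) = 0
}.

#[short(type="lieType")]
HB.structure Definition Lie (k : fieldType) :=
  {g of GRing.Lmodule k g & Lmodule_isLie k g}.

Definition associator (g : zmodType) (op : g -> g -> g) (x y z : g) : g :=
  op x (op y z) - op (op x y) z.

HB.mixin Record Lie_isPostLie (k : fieldType) g of Lie k g := {
  tri : g -> g -> g;
  tri_linearl : forall y, linear (tri^~ y);
  tri_linearr : forall x, linear (tri x);
  tri_lier : forall x y z : g,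
    tri x (lie y z) = lie (tri x y) z + lie y (tri x z);
  tri_liel : forall x y z : g,
    tri (lie x y) z = associator tri x y z - associator tri y x z
}.

#[short(type="postLieType")]
HB.structure Definition PostLie (k : fieldType) :=
  {g of Lie k g & Lie_isPostLie k g}.

(* The universal enveloping algebra, as the associative unital k-algebra
   presented by generators Gen x (x in g), subject to: Gen is linear and
   Gen [x, y] = Gen x * Gen y - Gen y * Gen x. *)

Inductive ue_expr (k : fieldType) (g : lieType k) : Type :=
| Gen of g
| EZero
| EOpp of ue_expr g
| EAdd of ue_expr g & ue_expr g
| EScale of k & ue_expr g
| EOne
| EMul of ue_expr g & ue_expr g.

Arguments EZero {k g}.
Arguments EOne {k g}.

HB.instance Definition _ (k : fieldType) (g : lieType k) :=
  gen_eqMixin (ue_expr g).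
HB.instance Definition _ (k : fieldType) (g : lieType k) :=
  gen_choiceMixin (ue_expr g).

Inductive ue_eq (k : fieldType) (g : lieType k) :
    ue_expr g -> ue_expr g -> Prop :=
| ue_refl a : ue_eq a a
| ue_sym a b : ue_eq a b -> ue_eq b a
| ue_trans b a c : ue_eq a b -> ue_eq b c -> ue_eq a c
| ue_congN a a' : ue_eq a a' -> ue_eq (EOpp a) (EOpp a')
| ue_congD a a' b b' :
    ue_eq a a' -> ue_eq b b' -> ue_eq (EAdd a b) (EAdd a' b')
| ue_congZ c a a' : ue_eq a a' -> ue_eq (EScale c a) (EScale c a')
| ue_congM a a' b b' :
    ue_eq a a' -> ue_eq b b' -> ue_eq (EMul a b) (EMul a' b')
| ue_addA a b c : ue_eq (EAdd a (EAdd b c)) (EAdd (EAdd a b) c)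
| ue_addC a b : ue_eq (EAdd a b) (EAdd b a)
| ue_add0 a : ue_eq (EAdd EZero a) a
| ue_addN a : ue_eq (EAdd (EOpp a) a) EZero
| ue_scaleA c d a : ue_eq (EScale c (EScale d a)) (EScale (c * d) a)
| ue_scale1 a : ue_eq (EScale 1 a) a
| ue_scaleDr c a b :
    ue_eq (EScale c (EAdd a b)) (EAdd (EScale c a) (EScale c b))
| ue_scaleDl a c d : ue_eq (EScale (c + d) a) (EAdd (EScale c a) (EScale d a))
| ue_mulA a b c : ue_eq (EMul a (EMul b c)) (EMul (EMul a b) c)
| ue_mul1l a : ue_eq (EMul EOne a) a
| ue_mul1r a : ue_eq (EMul a EOne) a
| ue_mulDl a b c : ue_eq (EMul (EAdd a b) c) (EAdd (EMul a c) (EMul b c))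
| ue_mulDr a b c : ue_eq (EMul a (EAdd b c)) (EAdd (EMul a b) (EMul a c))
| ue_scaleAl c a b : ue_eq (EScale c (EMul a b)) (EMul (EScale c a) b)
| ue_scaleAr c a b : ue_eq (EScale c (EMul a b)) (EMul a (EScale c b))
| ue_genD x y : ue_eq (Gen (x + y)) (EAdd (Gen x) (Gen y))
| ue_genZ c x : ue_eq (Gen (c *: x)) (EScale c (Gen x))
| ue_genL x y :
    ue_eq (Gen (lie x y))
          (EAdd (EMul (Gen x) (Gen y)) (EOpp (EMul (Gen y) (Gen x)))).

Section Enveloping.
Variables (k : fieldType) (g : lieType k).

Definition ue_rel (a b : ue_expr g) : bool := `[< ue_eq a b >].

Fact ue_rel_refl : reflexive ue_rel.
Proof. by move=> a; apply/asboolP/ue_refl. Qed.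
Fact ue_rel_sym : symmetric ue_rel.
Proof. by move=> a b; apply/asboolP/asboolP; apply: ue_sym. Qed.
Fact ue_rel_trans : transitive ue_rel.
Proof.
by move=> b a c /asboolP ab /asboolP bc; apply/asboolP/(ue_trans ab bc).
Qed.
Canonical ue_equiv := EquivRel ue_rel ue_rel_refl ue_rel_sym ue_rel_trans.

Definition enveloping := {eq_quot ue_equiv}.
HB.instance Definition _ := Choice.on enveloping.
HB.instance Definition _ := Quotient.on enveloping.
Local Notation U := enveloping.
Definition ue_class (a : ue_expr g) : U := \pi a.
Local Notation cl := ue_class.

Lemma ue_classW (P : U -> Prop) : (forall a, P (cl a)) -> forall u, P u.
Proof. by move=> Pcl u; rewrite -[u]reprK; apply: Pcl. Qed.

Lemma ue_piP a b : cl a = cl b <-> ue_eq a b.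
Proof.
split; first by move=> /eqmodP/asboolP.
by move=> ab; apply/eqmodP/asboolP.
Qed.

Lemma ue_reprK a : ue_eq (repr (cl a)) a.
Proof. by apply/ue_piP; rewrite /ue_class reprK. Qed.

Definition ue_zero : U := cl EZero.
Definition ue_opp (a : U) : U := cl (EOpp (repr a)).
Definition ue_add (a b : U) : U := cl (EAdd (repr a) (repr b)).
Definition ue_scale (c : k) (a : U) : U := cl (EScale c (repr a)).
Definition ue_one : U := cl EOne.
Definition ue_mul (a b : U) : U := cl (EMul (repr a) (repr b)).

Lemma ue_oppE a : ue_opp (cl a) = cl (EOpp a).
Proof. by apply/ue_piP/ue_congN/ue_reprK. Qed.
Lemma ue_addE a b : ue_add (cl a) (cl b) = cl (EAdd a b).
Proof. by apply/ue_piP/ue_congD; apply: ue_reprK. Qed.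
Lemma ue_scaleE c a : ue_scale c (cl a) = cl (EScale c a).
Proof. by apply/ue_piP/ue_congZ/ue_reprK. Qed.
Lemma ue_mulE a b : ue_mul (cl a) (cl b) = cl (EMul a b).
Proof. by apply/ue_piP/ue_congM; apply: ue_reprK. Qed.
Let opE := (ue_oppE, ue_addE, ue_scaleE, ue_mulE).

Fact ue_addrA : associative ue_add.
Proof.
by elim/ue_classW=> a; elim/ue_classW=> b; elim/ue_classW=> c; rewrite !opE;
  apply/ue_piP/ue_addA.
Qed.
Fact ue_addrC : commutative ue_add.
Proof.
by elim/ue_classW=> a; elim/ue_classW=> b; rewrite !opE; apply/ue_piP/ue_addC.
Qed.
Fact ue_add0r : left_id ue_zero ue_add.
Proof. by elim/ue_classW=> a; rewrite !opE; apply/ue_piP/ue_add0. Qed.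
Fact ue_addNr : left_inverse ue_zero ue_opp ue_add.
Proof. by elim/ue_classW=> a; rewrite !opE; apply/ue_piP/ue_addN. Qed.
HB.instance Definition _ :=
  GRing.isZmodule.Build U ue_addrA ue_addrC ue_add0r ue_addNr.

Fact ue_scalerA c d a : ue_scale c (ue_scale d a) = ue_scale (c * d) a.
Proof. by elim/ue_classW: a => a; rewrite !opE; apply/ue_piP/ue_scaleA. Qed.
Fact ue_scale1r : left_id 1 ue_scale.
Proof. by elim/ue_classW=> a; rewrite !opE; apply/ue_piP/ue_scale1. Qed.
Fact ue_scalerDr : right_distributive ue_scale +%R.
Proof.
by move=> c; elim/ue_classW=> a; elim/ue_classW=> b; rewrite /GRing.add /= !opE;
  apply/ue_piP/ue_scaleDr.
Qed.
Fact ue_scalerDl a : {morph ue_scale^~ a : c d / c + d}.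
Proof.
by elim/ue_classW: a => a c d; rewrite /= [RHS]/GRing.add /= !opE;
  apply/ue_piP/ue_scaleDl.
Qed.
HB.instance Definition _ := GRing.Zmodule_isLmodule.Build k U
  ue_scalerA ue_scale1r ue_scalerDr ue_scalerDl.

Fact ue_mulrA : associative ue_mul.
Proof.
by elim/ue_classW=> a; elim/ue_classW=> b; elim/ue_classW=> c; rewrite !opE;
  apply/ue_piP/ue_mulA.
Qed.
Fact ue_mul1 : left_id ue_one ue_mul.
Proof. by elim/ue_classW=> a; rewrite !opE; apply/ue_piP/ue_mul1l. Qed.
Fact ue_mulr1 : right_id ue_one ue_mul.
Proof. by elim/ue_classW=> a; rewrite !opE; apply/ue_piP/ue_mul1r. Qed.
Fact ue_mulrDl : left_distributive ue_mul +%R.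
Proof.
by elim/ue_classW=> a; elim/ue_classW=> b; elim/ue_classW=> c; rewrite /GRing.add /= !opE;
  apply/ue_piP/ue_mulDl.
Qed.
Fact ue_mulrDr : right_distributive ue_mul +%R.
Proof.
by elim/ue_classW=> a; elim/ue_classW=> b; elim/ue_classW=> c; rewrite /GRing.add /= !opE;
  apply/ue_piP/ue_mulDr.
Qed.
HB.instance Definition _ := GRing.Zmodule_isPzRing.Build U
  ue_mulrA ue_mul1 ue_mulr1 ue_mulrDl ue_mulrDr.

Fixpoint ue_aug (a : ue_expr g) : k :=
  match a with
  | Gen _ => 0
  | EZero => 0
  | EOpp a => - ue_aug a
  | EAdd a b => ue_aug a + ue_aug b
  | EScale c a => c * ue_aug a
  | EOne => 1
  | EMul a b => ue_aug a * ue_aug b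
  end.

Lemma ue_aug_eq a b : ue_eq a b -> ue_aug a = ue_aug b.
Proof.
elim=> //=.
- by move=> ? ? ? _ -> _ ->.
- by move=> ? ? _ ->.
- by move=> ? ? ? ? _ -> _ ->.
- by move=> ? ? ? _ ->.
- by move=> ? ? ? ? _ -> _ ->.
- by move=> *; rewrite addrA.
- by move=> *; rewrite addrC.
- by move=> *; rewrite add0r.
- by move=> *; rewrite addNr.
- by move=> *; rewrite mulrA.
- by move=> *; rewrite mul1r.
- by move=> *; rewrite mulrDr.
- by move=> *; rewrite mulrDl.
- by move=> *; rewrite mulrA.
- by move=> *; rewrite mul1r.
- by move=> *; rewrite mulr1.
- by move=> *; rewrite mulrDl.
- by move=> *; rewrite mulrDr.
- by move=> *; rewrite mulrA.
- by move=> *; rewrite mulrCA.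
- by rewrite addr0.
- by move=> *; rewrite mulr0.
- by rewrite mulr0 subr0.
Qed.

Fact ue_oner_neq0 : 1 != 0 :> U.
Proof.
by apply/eqP => /ue_piP/ue_aug_eq /= /eqP; rewrite oner_eq0.
Qed.
HB.instance Definition _ := GRing.PzSemiRing_isNonZero.Build U ue_oner_neq0.

Fact ue_scalerAl (c : k) (a b : U) : c *: (a * b) = c *: a * b.
Proof.
elim/ue_classW: a => a; elim/ue_classW: b => b.
by rewrite /GRing.mul /GRing.scale /= !opE; apply/ue_piP/ue_scaleAl.
Qed.
HB.instance Definition _ := GRing.Lmodule_isLalgebra.Build k U ue_scalerAl.

Fact ue_scalerAr (c : k) (a b : U) : c *: (a * b) = a * (c *: b).
Proof.
elim/ue_classW: a => a; elim/ue_classW: b => b.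
by rewrite /GRing.mul /GRing.scale /= !opE; apply/ue_piP/ue_scaleAr.
Qed.
HB.instance Definition _ := GRing.Lalgebra_isAlgebra.Build k U ue_scalerAr.

Lemma ue_class0 : cl EZero = 0. Proof. by []. Qed.
Lemma ue_class1 : cl EOne = 1. Proof. by []. Qed.
Lemma ue_classN a : cl (EOpp a) = - cl a.
Proof. by rewrite -ue_oppE. Qed.
Lemma ue_classD a b : cl (EAdd a b) = cl a + cl b.
Proof. by rewrite -ue_addE. Qed.
Lemma ue_classZ c a : cl (EScale c a) = c *: cl a.
Proof. by rewrite -ue_scaleE. Qed.
Lemma ue_classM a b : cl (EMul a b) = cl a * cl b.
Proof. by rewrite -ue_mulE. Qed.

Definition ue_gen (x : g) : U := cl (Gen x).

Fact ue_gen_linear : linear ue_gen.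
Proof.
move=> c x y; rewrite -ue_classZ -ue_classD; apply/ue_piP.
apply: ue_trans (ue_genD _ _) _; apply: ue_congD; last exact: ue_refl.
exact: ue_genZ.
Qed.
HB.instance Definition _ := GRing.isLinear.Build k g U _ ue_gen ue_gen_linear.

Lemma ue_gen_lie x y :
  ue_gen (lie x y) = ue_gen x * ue_gen y - ue_gen y * ue_gen x.
Proof.
rewrite -!ue_classM -ue_classN -ue_classD; apply/ue_piP.
exact: ue_genL.
Qed.

Lemma ue_ind (P : U -> Prop) :
  (forall x, P (ue_gen x)) -> P 1 ->
  (forall (c : k) a b, P a -> P b -> P (c *: a + b)) ->
  (forall a b, P a -> P b -> P (a * b)) ->
  forall a, P a.
Proof.
move=> Pg P1 PL PM; elim/ue_classW.
have P0 : P 0 by rewrite -[0](addNr 1) -scaleN1r; apply: PL.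
have PZ c a : P a -> P (c *: a) by move=> Pa; rewrite -[c *: a]addr0; apply: PL.
elim=> //.
- by move=> a Pa; rewrite ue_classN -scaleN1r; apply: PZ.
- by move=> a Pa b Pb; rewrite ue_classD -[cl a]scale1r; apply: PL.
- by move=> c a Pa; rewrite ue_classZ; apply: PZ.
- by move=> a Pa b Pb; rewrite ue_classM; apply: PM.
Qed.

End Enveloping.

Section EnvelopingLift.
Variables (k : fieldType) (g : lieType k) (B : algType k).
Variable f : g -> B.
Hypothesis f_linear : linear f.
Hypothesis f_lie : forall x y, f (lie x y) = f x * f y - f y * f x.

Fixpoint ue_eval (a : ue_expr g) : B :=
  match a with
  | Gen x => f x
  | EZero => 0
  | EOpp a => - ue_eval a
  | EAdd a b => ue_eval a + ue_eval b
  | EScale c a => c *: ue_eval a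
  | EOne => 1
  | EMul a b => ue_eval a * ue_eval b
  end.

Definition ue_lift (a : enveloping g) : B := ue_eval (repr a).

Lemma ue_eval_eq a b : ue_eq a b -> ue_eval a = ue_eval b.
Proof.
elim=> //=.
- by move=> ? ? ? _ -> _ ->.
- by move=> ? ? _ ->.
- by move=> ? ? ? ? _ -> _ ->.
- by move=> ? ? ? _ ->.
- by move=> ? ? ? ? _ -> _ ->.
- by move=> *; rewrite addrA.
- by move=> *; rewrite addrC.
- by move=> *; rewrite add0r.
- by move=> *; rewrite addNr.
- by move=> *; rewrite scalerA.
- by move=> *; rewrite scale1r.
- by move=> *; rewrite scalerDr.
- by move=> *; rewrite scalerDl.
- by move=> *; rewrite mulrA.
- by move=> *; rewrite mul1r.
- by move=> *; rewrite mulr1.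
- by move=> *; rewrite mulrDl.
- by move=> *; rewrite mulrDr.
- by move=> *; rewrite scalerAl.
- by move=> *; rewrite scalerAr.
- by move=> x y; rewrite -[x]scale1r f_linear !scale1r.
- have f0 : f 0 = 0 by rewrite -[0](addNr 0) -scaleN1r f_linear scaleN1r addNr.
  by move=> c x; rewrite -[c *: x]addr0 f_linear f0 addr0.
Qed.

Lemma ue_lift_pi a : ue_lift (ue_class a) = ue_eval a.
Proof. by apply/ue_eval_eq/ue_reprK. Qed.

Lemma ue_lift_gen x : ue_lift (ue_gen x) = f x.
Proof. by rewrite ue_lift_pi. Qed.

Lemma ue_lift_linear : linear ue_lift.
Proof.
move=> c; elim/ue_classW=> a; elim/ue_classW=> b.
by rewrite -ue_classZ -ue_classD !ue_lift_pi.
Qed.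

Lemma ue_lift_monoid_morphism : monoid_morphism ue_lift.
Proof.
split; first by rewrite ue_lift_pi.
elim/ue_classW=> a; elim/ue_classW=> b.
by rewrite -ue_classM !ue_lift_pi.
Qed.

Lemma ue_lift_uniq (h : {lrmorphism enveloping g -> B}) :
  (forall x, h (ue_gen x) = f x) -> h =1 ue_lift.
Proof.
move=> hg; apply: ue_ind => [x||c a b ha hb|a b ha hb].
- by rewrite hg ue_lift_gen.
- by rewrite rmorph1 ue_lift_monoid_morphism.1.
- by rewrite linearP /= ha hb ue_lift_linear.
- by rewrite rmorphM /= ha hb ue_lift_monoid_morphism.2.
Qed.

End EnvelopingLift.

(* The tensor product over k: finite formal sums of pairs (u, v), modulo the
   congruence generated by bilinearity.  As formal sums only form a monoid,
   that (0, v) is the empty sum has to be imposed. *)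

Inductive tens_eq (k : fieldType) (V W : lmodType k) :
    seq (V * W) -> seq (V * W) -> Prop :=
| tens_refl s : tens_eq s s
| tens_sym s t : tens_eq s t -> tens_eq t s
| tens_trans t s r : tens_eq s t -> tens_eq t r -> tens_eq s r
| tens_congD s s' t t' :
    tens_eq s s' -> tens_eq t t' -> tens_eq (s ++ t) (s' ++ t')
| tens_addC s t : tens_eq (s ++ t) (t ++ s)
| tens_0l w : tens_eq [:: (0, w)] [::]
| tens_Dl v v' w : tens_eq [:: (v + v', w)] [:: (v, w); (v', w)]
| tens_Dr v w w' : tens_eq [:: (v, w + w')] [:: (v, w); (v, w')]
| tens_Z c v w : tens_eq [:: (c *: v, w)] [:: (v, c *: w)].

Arguments tens_0l {k V W} w.

Section Tensor.
Variables (k : fieldType) (V W : lmodType k).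

Definition tens_rel (s t : seq (V * W)) : bool := `[< tens_eq s t >].

Fact tens_rel_refl : reflexive tens_rel.
Proof. by move=> s; apply/asboolP/tens_refl. Qed.
Fact tens_rel_sym : symmetric tens_rel.
Proof. by move=> s t; apply/asboolP/asboolP; apply: tens_sym. Qed.
Fact tens_rel_trans : transitive tens_rel.
Proof.
by move=> t s r /asboolP st /asboolP tr; apply/asboolP/(tens_trans st tr).
Qed.
Canonical tens_equiv :=
  EquivRel tens_rel tens_rel_refl tens_rel_sym tens_rel_trans.

Definition tensor := {eq_quot tens_equiv}.
HB.instance Definition _ := Choice.on tensor.
HB.instance Definition _ := Quotient.on tensor.
Local Notation T := tensor.
Definition tens_class (s : seq (V * W)) : T := \pi s.
Local Notation cl := tens_class.

Lemma tens_classW (P : T -> Prop) : (forall s, P (cl s)) -> forall t, P t.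
Proof. by move=> Pcl t; rewrite -[t]reprK; apply: Pcl. Qed.

Lemma tens_piP s t : cl s = cl t <-> tens_eq s t.
Proof.
split; first by move=> /eqmodP/asboolP.
by move=> st; apply/eqmodP/asboolP.
Qed.

Lemma tens_reprK s : tens_eq (repr (cl s)) s.
Proof. by apply/tens_piP; rewrite /tens_class reprK. Qed.

Lemma tens_eq_mapl (Y : Type) (F : Y -> seq (V * W)) (F' : Y -> seq (V * W)) s :
  (forall y, tens_eq (F y) (F' y)) ->
  tens_eq (flatten [seq F y | y <- s]) (flatten [seq F' y | y <- s]).
Proof.
move=> FF'; elim: s => [|y s IHs] /=; first exact: tens_refl.
exact: tens_congD.
Qed.

Definition tens_zero : T := cl [::].
Definition tens_add (s t : T) : T := cl (repr s ++ repr t).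
Definition fscale (c : k) (s : seq (V * W)) := [seq (c *: p.1, p.2) | p <- s].
Definition tens_scale (c : k) (s : T) : T := cl (fscale c (repr s)).
Definition tens_opp (s : T) : T := tens_scale (- 1) s.

Lemma fscale_eq c s t : tens_eq s t -> tens_eq (fscale c s) (fscale c t).
Proof.
elim=> {s t}.
- by move=> s; apply: tens_refl.
- by move=> s t _; apply: tens_sym.
- by move=> t s r _ st _; apply: tens_trans.
- by move=> s s' t t' _ ss' _ tt'; rewrite /fscale !map_cat; apply: tens_congD.
- by move=> s t; rewrite /fscale !map_cat; apply: tens_addC.
- by move=> w; rewrite /fscale /= scaler0; apply: tens_0l.
- by move=> v v' w; rewrite /fscale /= scalerDr; apply: tens_Dl.
- by move=> v w w'; apply: tens_Dr.
- by move=> d v w; rewrite /fscale /= scalerA mulrC -scalerA; apply: tens_Z.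
Qed.

Lemma tens_addE s t : tens_add (cl s) (cl t) = cl (s ++ t).
Proof. by apply/tens_piP/tens_congD; apply: tens_reprK. Qed.
Lemma tens_scaleE c s : tens_scale c (cl s) = cl (fscale c s).
Proof. by apply/tens_piP/fscale_eq/tens_reprK. Qed.

Fact tens_addrA : associative tens_add.
Proof.
by elim/tens_classW=> s; elim/tens_classW=> t; elim/tens_classW=> r; rewrite !tens_addE catA.
Qed.
Fact tens_addrC : commutative tens_add.
Proof.
by elim/tens_classW=> s; elim/tens_classW=> t; rewrite !tens_addE; apply/tens_piP/tens_addC.
Qed.
Fact tens_add0r : left_id tens_zero tens_add.
Proof. by elim/tens_classW=> s; rewrite tens_addE. Qed.

Lemma fscaleDl s c d :
  tens_eq (fscale (c + d) s) (fscale c s ++ fscale d s).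
Proof.
elim: s => [|[v w] s IHs]; first exact: tens_refl.
rewrite /= -cat1s scalerDl; apply: tens_trans (tens_congD (tens_Dl _ _ _) IHs) _.
rewrite /= -(cat1s (c *: v, w) (_ :: _)) -(cat1s (c *: v, w) (_ ++ _)).
apply: tens_congD; first exact: tens_refl.
rewrite -cat1s catA -(cat1s (d *: v, w) (fscale d s)) catA.
by apply: tens_congD; [apply: tens_addC | apply: tens_refl].
Qed.

Lemma fscale0 s : tens_eq (fscale 0 s) [::].
Proof.
elim: s => [|[v w] s IHs]; first exact: tens_refl.
by rewrite /= -cat1s scale0r; apply: (tens_congD (tens_0l w) IHs).
Qed.

Lemma fscale1 s : fscale 1 s = s.
Proof. by rewrite /fscale -[RHS]map_id; apply: eq_map => -[v w]; rewrite scale1r. Qed.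

Fact tens_addNr : left_inverse tens_zero tens_opp tens_add.
Proof.
elim/tens_classW=> s; rewrite /tens_opp tens_scaleE tens_addE; apply/tens_piP.
rewrite -{2}(fscale1 s); apply: tens_trans (tens_sym (fscaleDl _ _ _)) _.
by rewrite addNr; apply: fscale0.
Qed.
HB.instance Definition _ :=
  GRing.isZmodule.Build T tens_addrA tens_addrC tens_add0r tens_addNr.

Fact tens_scalerA c d s : tens_scale c (tens_scale d s) = tens_scale (c * d) s.
Proof.
elim/tens_classW: s => s; rewrite !tens_scaleE /fscale -map_comp.
by congr cl; apply: eq_map => -[v w] /=; rewrite scalerA.
Qed.
Fact tens_scale1r : left_id 1 tens_scale.
Proof. by elim/tens_classW=> s; rewrite tens_scaleE fscale1. Qed.
Fact tens_scalerDr : right_distributive tens_scale +%R.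
Proof.
move=> c; elim/tens_classW=> s; elim/tens_classW=> t; rewrite /GRing.add /=.
by rewrite tens_addE !tens_scaleE tens_addE /fscale map_cat.
Qed.
Fact tens_scalerDl s : {morph tens_scale^~ s : c d / c + d}.
Proof.
elim/tens_classW: s => s c d /=; rewrite [RHS]/GRing.add /= !tens_scaleE tens_addE.
exact/tens_piP/fscaleDl.
Qed.
HB.instance Definition _ := GRing.Zmodule_isLmodule.Build k T
  tens_scalerA tens_scale1r tens_scalerDr tens_scalerDl.

Lemma tens_classD s t : cl (s ++ t) = cl s + cl t.
Proof. by rewrite -tens_addE. Qed.
Lemma tens_classZ c s : cl (fscale c s) = c *: cl s.
Proof. by rewrite -tens_scaleE. Qed.

Definition tens (v : V) (w : W) : T := cl [:: (v, w)].

Lemma tens_linearl w : linear (tens^~ w).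
Proof.
move=> c v v'; rewrite -tens_classZ -tens_classD.
exact/tens_piP/tens_Dl.
Qed.
Lemma tens_linearr v : linear (tens v).
Proof.
move=> c w w'; rewrite -tens_classZ -tens_classD; apply/tens_piP; apply: tens_trans (tens_Dr _ _ _) _.
rewrite -cat1s -[X in tens_eq _ X]cat1s; apply: tens_congD; last exact: tens_refl.
exact/tens_sym/tens_Z.
Qed.

Lemma tensZl c v w : tens (c *: v) w = c *: tens v w.
Proof. by case: (linear_morph (tens_linearl w)). Qed.

Lemma tens_piE s : cl s = \sum_(p <- s) tens p.1 p.2.
Proof.
elim: s => [|[v w] s IHs]; first by rewrite big_nil.
by rewrite big_cons -IHs -tens_classD.
Qed.

Lemma tens_span (t : T) : exists s, t = \sum_(p <- s) tens p.1 p.2.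
Proof. by elim/tens_classW: t => s; exists s; rewrite tens_piE. Qed.

End Tensor.

Section TensorLift.
Variables (k : fieldType) (V W X : lmodType k) (f : V -> W -> X).
Hypothesis f_linearl : forall w, linear (f^~ w).
Hypothesis f_linearr : forall v, linear (f v).

Definition tens_lift (t : tensor V W) : X := \sum_(p <- repr t) f p.1 p.2.

Lemma tens_sum_eq s t : tens_eq s t ->
  \sum_(p <- s) f p.1 p.2 = \sum_(p <- t) f p.1 p.2.
Proof.
elim=> {s t} //.
- by move=> ? ? ? _ -> _ ->.
- by move=> ? ? ? ? _ e1 _ e2; rewrite !big_cat e1 e2.
- by move=> s t; rewrite !big_cat /= addrC.
- by move=> w; rewrite big_seq1 big_nil; case: (linear_morph (f_linearl w)).
- by move=> v v' w; rewrite !big_cons big_nil /= !addr0; case: (linear_morph (f_linearl w)) => _ ->.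
- by move=> v w w'; rewrite !big_cons big_nil /= !addr0; case: (linear_morph (f_linearr v)) => _ ->.
- move=> c v w; rewrite !big_seq1 /=.
  by case: (linear_morph (f_linearl w)) (linear_morph (f_linearr v))
    => _ _ -> [_ _ ->].
Qed.

Lemma tens_lift_pi s : tens_lift (tens_class s) = \sum_(p <- s) f p.1 p.2.
Proof. by apply/tens_sum_eq/tens_reprK. Qed.

Lemma tens_liftE v w : tens_lift (tens v w) = f v w.
Proof. by rewrite tens_lift_pi big_seq1. Qed.

Lemma tens_lift_linear : linear tens_lift.
Proof.
move=> c; elim/tens_classW=> s; elim/tens_classW=> t.
rewrite -tens_classZ -tens_classD !tens_lift_pi big_cat big_map scaler_sumr.
congr (_ + _); apply: eq_bigr => -[v w] _ /=.
by case: (linear_morph (f_linearl w)).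
Qed.

End TensorLift.

Section TensorAlgebra.
Variables (k : fieldType) (A B : algType k).
Local Notation T := (tensor A B).

Definition fmul (s t : seq (A * B)) : seq (A * B) :=
  [seq (p.1 * q.1, p.2 * q.2) | p <- s, q <- t].
Definition tensA_one : T := tens 1 1.
Definition tensA_mul (s t : T) : T := tens_class (fmul (repr s) (repr t)).

Lemma fmul_sum s t : tens_class (fmul s t) =
  \sum_(p <- s) \sum_(q <- t) tens (p.1 * q.1) (p.2 * q.2).
Proof.
rewrite tens_piE /fmul big_allpairs_dep /=.
by apply: eq_bigr => p _; apply: eq_bigr => q _.
Qed.

Lemma fmul_eql s s' t : tens_eq s s' -> tens_class (fmul s t) = tens_class (fmul s' t).
Proof.
move=> ss'; rewrite !fmul_sum exchange_big [RHS]exchange_big /=.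
apply: eq_bigr => q _.
apply: (tens_sum_eq (f := fun a b => tens (a * q.1) (b * q.2))) => //.
- by move=> b c a a'; rewrite mulrDl -scalerAl tens_linearl.
- by move=> a c b b'; rewrite mulrDl -scalerAl tens_linearr.
Qed.

Lemma fmul_eqr s t t' : tens_eq t t' -> tens_class (fmul s t) = tens_class (fmul s t').
Proof.
move=> tt'; rewrite !fmul_sum; apply: eq_bigr => p _.
apply: (tens_sum_eq (f := fun a b => tens (p.1 * a) (p.2 * b))) => //.
- by move=> b c a a'; rewrite mulrDr -scalerAr tens_linearl.
- by move=> a c b b'; rewrite mulrDr -scalerAr tens_linearr.
Qed.

Lemma tensA_mulE s t : tensA_mul (tens_class s) (tens_class t) = tens_class (fmul s t).
Proof.
by rewrite /tensA_mul (fmul_eql _ (tens_reprK s)) (fmul_eqr _ (tens_reprK t)).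
Qed.

Fact tensA_mulrDl : left_distributive tensA_mul +%R.
Proof.
elim/tens_classW=> s; elim/tens_classW=> t; elim/tens_classW=> r.
by rewrite -tens_classD !tensA_mulE -tens_classD /fmul allpairs_cat.
Qed.
Fact tensA_mulrDr : right_distributive tensA_mul +%R.
Proof.
elim/tens_classW=> s; elim/tens_classW=> t; elim/tens_classW=> r.
rewrite -tens_classD !tensA_mulE !fmul_sum.
by rewrite -big_split; apply: eq_bigr => p _; rewrite big_cat.
Qed.
Fact tensA_mul1r : left_id tensA_one tensA_mul.
Proof.
elim/tens_classW=> s; rewrite tensA_mulE fmul_sum big_seq1 tens_piE.
by apply: eq_bigr => p _; rewrite !mul1r.
Qed.
Fact tensA_mulr1 : right_id tensA_one tensA_mul.
Proof.
elim/tens_classW=> s; rewrite tensA_mulE fmul_sum tens_piE.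
by apply: eq_bigr => p _; rewrite big_seq1 !mulr1.
Qed.
Fact tensA_mulrA : associative tensA_mul.
Proof.
elim/tens_classW=> s; elim/tens_classW=> t; elim/tens_classW=> r; rewrite !tensA_mulE !fmul_sum.
rewrite /fmul big_allpairs_dep /=; apply: eq_bigr => p _.
rewrite big_allpairs_dep /=; apply: eq_bigr => q _.
by apply: eq_bigr => o _; rewrite !mulrA.
Qed.
HB.instance Definition _ := GRing.Zmodule_isPzRing.Build T
  tensA_mulrA tensA_mul1r tensA_mulr1 tensA_mulrDl tensA_mulrDr.

Lemma tensM a b a' b' : tens a b * tens a' b' = tens (a * a') (b * b') :> T.
Proof. exact: tensA_mulE. Qed.

Lemma tens_scalerAl (c : k) (s t : T) : c *: (s * t) = c *: s * t.
Proof.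
have [s' ->] := tens_span s; have [t' ->] := tens_span t.
rewrite scaler_sumr !mulr_suml scaler_sumr; apply: eq_bigr => p _.
rewrite !mulr_sumr scaler_sumr; apply: eq_bigr => q _.
by rewrite -tensZl !tensM -tensZl scalerAl.
Qed.

Lemma tens_scalerAr (c : k) (s t : T) : c *: (s * t) = s * (c *: t).
Proof.
have [s' ->] := tens_span s; have [t' ->] := tens_span t.
rewrite scaler_sumr !mulr_suml scaler_sumr; apply: eq_bigr => p _.
rewrite !mulr_sumr scaler_sumr; apply: eq_bigr => q _.
by rewrite -tensZl !tensM -tensZl scalerAr.
Qed.

End TensorAlgebra.

Section Coproduct.
Variables (k : fieldType) (g : lieType k).
Local Notation U := (enveloping g).

(* A mathcomp algebra must satisfy 1 != 0; the augmentation of U provides it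
   for the tensor square. *)
Definition ue_tensor := tensor U U.
HB.instance Definition _ := GRing.Lmodule.on ue_tensor.
HB.instance Definition _ := GRing.PzRing.on ue_tensor.

Let eps (a : U) : k^o := ue_lift (fun=> 0 : k^o) a.
Let zero_linear : linear ((fun=> 0) : g -> k^o).
Proof. by move=> c x y; rewrite scaler0 addr0. Qed.
Let zero_lie (x y : g) : 0 = 0 * 0 - 0 * 0 :> k^o.
Proof. by rewrite mulr0 subr0. Qed.

Fact ue_tensor_oner_neq0 : 1 != 0 :> ue_tensor.
Proof.
have epsL : linear eps by apply: ue_lift_linear.
have epsl b : linear (fun a => eps a * eps b).
  by move=> c a a'; rewrite epsL mulrDl scalerAl.
have epsr a : linear (fun b => eps a * eps b).
  by move=> c b b'; rewrite epsL mulrDr scalerAr.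
have eps1 : eps 1 = 1 by apply: (ue_lift_monoid_morphism zero_linear zero_lie).1.
apply/eqP => /tens_piP /(tens_sum_eq epsl epsr).
by rewrite big_seq1 big_nil /= eps1 mulr1 => /eqP; rewrite oner_eq0.
Qed.
HB.instance Definition _ :=
  GRing.PzSemiRing_isNonZero.Build ue_tensor ue_tensor_oner_neq0.
HB.instance Definition _ :=
  GRing.Lmodule_isLalgebra.Build k ue_tensor (@tens_scalerAl k U U).
HB.instance Definition _ :=
  GRing.Lalgebra_isAlgebra.Build k ue_tensor (@tens_scalerAr k U U).

Definition primitive (x : g) : ue_tensor :=
  tens (ue_gen x) 1 + tens 1 (ue_gen x).

Fact primitive_linear : linear primitive.
Proof.
move=> c x y; rewrite /primitive linearP tens_linearl tens_linearr.
by rewrite scalerDr addrACA.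
Qed.

Fact primitive_lie x y : primitive (lie x y) =
  primitive x * primitive y - primitive y * primitive x.
Proof.
rewrite /primitive ue_gen_lie; set a := ue_gen x; set b := ue_gen y.
have [_ lD lZ] := linear_morph (@tens_linearl k U U 1).
have [_ rD rZ] := linear_morph (@tens_linearr k U U 1).
have tM (u v u' v' : U) : (tens u v : ue_tensor) * tens u' v' =
  tens (u * u') (v * v') by apply: tensM.
rewrite -!scaleN1r lD rD lZ rZ !scaleN1r.
rewrite !(mulrDl, mulrDr) !tM !(mulr1, mul1r).
set p : ue_tensor := tens (a * b) 1; set q : ue_tensor := tens a b.
set r : ue_tensor := tens b a; set s : ue_tensor := tens 1 (a * b).
set p' : ue_tensor := tens (b * a) 1; set s' : ue_tensor := tens 1 (b * a).
have -> : p + q + (r + s) = (q + r) + (p + s) :> ue_tensor.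
  by rewrite (addrC p) addrACA.
have -> : p' + r + (q + s') = (q + r) + (p' + s') :> ue_tensor.
  by rewrite (addrC p') addrACA (addrC r).
by rewrite opprD [RHS]addrACA subrr add0r opprD [RHS]addrACA.
Qed.

Definition coproduct : enveloping g -> ue_tensor := ue_lift primitive.

HB.instance Definition _ := GRing.isLinear.Build k U ue_tensor _ coproduct
  (ue_lift_linear primitive_linear primitive_lie).
HB.instance Definition _ := GRing.isMonoidMorphism.Build U ue_tensor coproduct
  (ue_lift_monoid_morphism primitive_linear primitive_lie).

Lemma coproduct_gen x :
  coproduct (ue_gen x) = tens (ue_gen x) 1 + tens 1 (ue_gen x).
Proof. exact: ue_lift_gen primitive_linear primitive_lie x. Qed.

End Coproduct.

(* Main.v *)
From HB Require Import structures.
Require Import Defs.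
From mathcomp Require Import all_boot all_order all_algebra.
From mathcomp Require Import boolp functions.

Set Implicit Arguments.
Unset Strict Implicit.
Unset Printing Implicit Defensive.

Import GRing.Theory.
Local Open Scope ring_scope.

(** Write d_x for the derivation of U(g) that extends y |-> x |> y.  An
    extension of |> satisfies 1 |> 1 = 1 and, on a nonempty word w, w |> 1 = 0:
    in the coproduct of w all terms other than w (x) 1 and 1 (x) w are tensors
    of shorter nonempty words, so 1 = 1 * 1 and the product rule give
    w |> 1 = 2 (w |> 1) by induction on the length.  Hence x |> B = d_x B, and
    (xA) |> y = d_x (A |> y) - (d_x A) |> y.  Since d_x preserves word length,
    this determines A |> y, and the product rule determines the rest.

    For existence, the recursion
      (xA) |> B = d_x (A |> B) - (d_x A) |> B                             (1)
    has to be shown compatible with the relations of U(g).  It says that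
    x * A := xA + d_x A acts as d_x does after A.  The operators x * _ obey the
    composition bracket [[x, y]] = x |> y - y |> x + [x, y], and so do the
    derivations d_x.  Let gbar be g with that bracket.  If A in U(g) can be
    turned into an element Psi(A) of U(gbar), then A |> B can be defined as the
    action of Psi(A) on B through the derivations d, and (1) becomes
      Psi(xA) = x Psi(A) - Psi(d_x A).
    To obtain Psi without a basis theorem, g itself is made to act on U(gbar),
    and Psi(A) is what A makes of 1.  The operator of x in g must be
    u |-> x u - dbar_x u, where dbar is the transport of d to U(gbar); a
    computation suggests the commutation rule
      dbar_x (y u) = y dbar_x u + (x |> y) u + dbar_([x, y] - y |> x) u.  (2)
    The pair (x |> y, [x, y] - y |> x) is a matched pair of gbar with itself,
    and a matched pair (m, h) always yields an action of m on U(h) with a rule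
    of the form (2) (lemmas mp_act_genM and mp_act_lie); d is the case of the
    matched pair (x |> y, 0) of gbar with g.  Such an action is in turn built
    from the universal property alone: U(h) acts on pairs (u, f), where f is a
    linear map from m to U(h) recording the values dbar_x u for all x at once,
    so that (2) involves only the current pair and is no longer a recursion.

    Finally the product rule holds for 1 and passes from A to x * A, because
    x * _ is a coderivation (coproduct_shift) and d_x a derivation; and 1
    generates U(g) under the operators x * _ (shift_ind). *)

(** * Deciding identities in abelian groups *)

Inductive zmod_expr :=
| ZVar of nat | ZZero | ZOpp of zmod_expr | ZAdd of zmod_expr & zmod_expr.

Fixpoint zmod_eval (V : zmodType) (env : seq V) (e : zmod_expr) : V :=
  match e with
  | ZVar i => env`_i
  | ZZero => 0
  | ZOpp a => - zmod_eval env a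
  | ZAdd a b => zmod_eval env a + zmod_eval env b
  end.

Fixpoint zmod_coef (e : zmod_expr) (i : nat) : int :=
  match e with
  | ZVar j => if j == i then 1 else 0
  | ZZero => 0
  | ZOpp a => - zmod_coef a i
  | ZAdd a b => zmod_coef a i + zmod_coef b i
  end.

Lemma zmod_evalE (V : zmodType) (env : seq V) e :
  zmod_eval env e = \sum_(i < size env) env`_i *~ zmod_coef e i.
Proof.
elim: e => [j||a IHa|a IHa b IHb] /=.
- under eq_bigr => i _ do rewrite (fun_if (fun c : int => env`_i *~ c)) mulr0z
  mulr1z.
  rewrite -big_mkcond; case: (ltnP j (size env)) => [ltj|lej].
    by rewrite (big_pred1 (Ordinal ltj)) // => i; rewrite eq_sym.
  rewrite nth_default // big_pred0 // => i.
  by apply/eqP => ji; move: (ltn_ord i); rewrite -ji ltnNge lej.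
- by rewrite big1 // => i _; rewrite mulr0z.
- by rewrite IHa -sumrN; apply: eq_bigr => i _; rewrite mulrNz.
- by rewrite IHa IHb -big_split; apply: eq_bigr => i _; rewrite mulrzDr.
Qed.

Lemma zmod_eval_eq (V : zmodType) (env : seq V) a b :
  all (fun i => zmod_coef a i == zmod_coef b i) (iota 0 (size env)) ->
  zmod_eval env a = zmod_eval env b.
Proof.
move=> /allP ab; rewrite !zmod_evalE; apply: eq_bigr => i _.
by rewrite (eqP (ab i _)) // mem_iota ltn_ord.
Qed.

(* Equal atoms may carry different but convertible structure instances, so
   atoms are compared up to conversion; keeping the ring operations opaque
   makes the failing comparisons cheap. *)
Create HintDb zmod_atom discriminated.
#[export] Hint Constants Transparent : zmod_atom.
#[export] Hint Opaque GRing.add GRing.opp GRing.zero GRing.one GRing.mul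
  GRing.scale : zmod_atom.

Ltac zmod_same t u := constr:(ltac:(unify t u with zmod_atom; exact tt)).
Ltac zmod_insert t env :=
  lazymatch env with
  | [::] => constr:([:: t])
  | ?u :: ?l =>
      match goal with
      | _ => let _ := zmod_same t u in env
      | _ => let l' := zmod_insert t l in constr:(u :: l')
      end
  end.
Ltac zmod_atoms t env :=
  lazymatch t with
  | 0%R => env
  | (- ?a)%R => zmod_atoms a env
  | (?a + ?b)%R => let env' := zmod_atoms a env in zmod_atoms b env'
  | _ => zmod_insert t env
  end.
Ltac zmod_index t env :=
  lazymatch env with
  | ?u :: ?l =>
      match goal with
      | _ => let _ := zmod_same t u in constr:(0%N)
      | _ => let n := zmod_index t l in constr:(S n)
      end
  end.
Ltac zmod_reify t env :=
  lazymatch t with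
  | 0%R => constr:(ZZero)
  | (- ?a)%R => let a' := zmod_reify a env in constr:(ZOpp a')
  | (?a + ?b)%R =>
      let a' := zmod_reify a env in
      let b' := zmod_reify b env in constr:(ZAdd a' b')
  | _ => let n := zmod_index t env in constr:(ZVar n)
  end.

(** Proves equalities that hold in every abelian group when the maximal
    subterms other than sums, opposites and 0 are read as variables. *)
Ltac abelian :=
  lazymatch goal with
  | |- @eq ?V ?a ?b =>
      let env := zmod_atoms a (@nil V) in
      let env := zmod_atoms b env in
      let a' := zmod_reify a env in
      let b' := zmod_reify b env in
      exact: (@zmod_eval_eq _ env a' b' isT)
  end.

(** * Modules over the enveloping algebra *)

(** A representation of g on a subspace S of V.  The subspace is a predicate
    rather than a type, so that S can be the space of linear maps inside a space
    of functions; the operators are total, but only [S] has to see a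
    representation. *)
Record lie_action (k : fieldType) (g : lieType k) (V : lmodType k)
    (S : V -> Prop) (act : g -> V -> V) : Prop := LieAction {
  lact_S0 : S 0;
  lact_S_linear : forall c v w, S v -> S w -> S (c *: v + w);
  lact_S_act : forall x v, S v -> S (act x v);
  lact_linearl : forall v, S v -> linear (act^~ v);
  lact_linearr : forall x, linear (act x);
  lact_lie : forall x y v, S v ->
    act (lie x y) v = act x (act y v) - act y (act x v)
}.

Section EnvelopingModule.
Variables (k : fieldType) (g : lieType k) (V : lmodType k).
Variables (S : V -> Prop) (act : g -> V -> V).
Hypothesis actP : lie_action S act.
Let S0 := lact_S0 actP.
Let S_linear := lact_S_linear actP.
Let S_act := lact_S_act actP.
Let act_linearl := lact_linearl actP.
Let act_linearr := lact_linearr actP.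
Let act_lie := lact_lie actP.

(** Evaluating expressions directly as operators on V gives the extension of a
    representation to U(g) without an algebra of endomorphisms. *)
Fixpoint ue_act_eval (a : ue_expr g) (v : V) : V :=
  match a with
  | Gen x => act x v
  | EZero => 0
  | EOpp a => - ue_act_eval a v
  | EAdd a b => ue_act_eval a v + ue_act_eval b v
  | EScale c a => c *: ue_act_eval a v
  | EOne => v
  | EMul a b => ue_act_eval a (ue_act_eval b v)
  end.

Let S_scale c v : S v -> S (c *: v).
Proof. by move=> Sv; rewrite -[_ *: v]addr0; apply: S_linear. Qed.

Let S_add v w : S v -> S w -> S (v + w).
Proof. by move=> Sv Sw; rewrite -[v]scale1r; apply: S_linear. Qed.

Lemma ue_act_eval_stable a v : S v -> S (ue_act_eval a v).
Proof.
elim: a v => //= [a IH|a IHa b IHb|c a IH|a IHa b IHb] v Sv; auto.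
by rewrite -scaleN1r; auto.
Qed.

Lemma ue_act_eval_linear a : linear (ue_act_eval a).
Proof.
elim: a => [x||a IH|a IHa b IHb|d a IH||a IHa b IHb] c v w //=.
- exact: act_linearr.
- by rewrite scaler0 addr0.
- by rewrite IH opprD scalerN.
- by rewrite IHa IHb scalerDr addrACA.
- by rewrite IH scalerDr !scalerA mulrC.
- by rewrite IHb IHa.
Qed.

Lemma ue_act_eval_eq a b : ue_eq a b ->
  forall v, S v -> ue_act_eval a v = ue_act_eval b v.
Proof.
have evL a' := linear_morph (ue_act_eval_linear a').
elim=> {a b} //=.
- by move=> a b _ ab v Sv; rewrite ab.
- by move=> a b c _ ab _ bc v Sv; rewrite ab // bc.
- by move=> a a' _ aa v Sv; rewrite aa.
- by move=> a a' b b' _ aa _ bb v Sv; rewrite aa // bb.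
- by move=> c a a' _ aa v Sv; rewrite aa.
- move=> a a' b b' _ aa _ bb v Sv; rewrite bb //.
  by apply/aa/ue_act_eval_stable.
- by move=> *; rewrite addrA.
- by move=> *; rewrite addrC.
- by move=> *; rewrite add0r.
- by move=> *; rewrite addNr.
- by move=> *; rewrite scalerA.
- by move=> *; rewrite scale1r.
- by move=> *; rewrite scalerDr.
- by move=> *; rewrite scalerDl.
- by move=> a b c v _; have [_ -> _] := evL a.
- by move=> c a b v _; have [_ _ ->] := evL a.
- by move=> x y v Sv; have [_ -> _] := linear_morph (act_linearl Sv).
- by move=> c x v Sv; have [_ _ ->] := linear_morph (act_linearl Sv).
Qed.

Definition ue_act (a : enveloping g) (v : V) : V := ue_act_eval (repr a) v.

Lemma ue_act_class a v : S v -> ue_act (ue_class a) v = ue_act_eval a v.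
Proof. by apply/ue_act_eval_eq/ue_reprK. Qed.

Lemma ue_act_linear a : linear (ue_act a).
Proof. exact: ue_act_eval_linear. Qed.

Lemma ue_act_stable a v : S v -> S (ue_act a v).
Proof. exact: ue_act_eval_stable. Qed.

Lemma ue_act_linearl v : S v -> linear (ue_act^~ v).
Proof.
move=> Sv c; elim/ue_classW=> a; elim/ue_classW=> b.
by rewrite -ue_classZ -ue_classD !ue_act_class.
Qed.

Lemma ue_act1 v : S v -> ue_act 1 v = v.
Proof. by move=> Sv; rewrite -ue_class1 ue_act_class. Qed.

Lemma ue_act_gen x v : S v -> ue_act (ue_gen x) v = act x v.
Proof. exact: ue_act_class. Qed.

Lemma ue_actM a b v : S v -> ue_act (a * b) v = ue_act a (ue_act b v).
Proof.
elim/ue_classW: a => a; elim/ue_classW: b => b Sv.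
by rewrite -ue_classM !ue_act_class //; apply: ue_act_eval_stable.
Qed.

End EnvelopingModule.

(** * Words, induction principles and the coproduct *)

Section Words.
Variables (k : fieldType) (g : lieType k).
Local Notation U := (enveloping g).

Definition linear_stable (V : lmodType k) (P : V -> Prop) :=
  forall c a b, P a -> P b -> P (c *: a + b).

Lemma linear_stable0 (V : lmodType k) (P : V -> Prop) a :
  linear_stable P -> P a -> P 0.
Proof. by move=> PL Pa; rewrite -[0](addNr a) -scaleN1r; apply: PL. Qed.

Lemma linear_eq_stable (V W : lmodType k) (f h : V -> W) :
  linear f -> linear h -> linear_stable (fun a => f a = h a).
Proof. by move=> fL hL c a b fa fb; rewrite fL hL fa fb. Qed.

(** Left multiplications by generators already reach everything from 1: apply
    induction on A to the property that multiplication by A preserves P. *)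
Lemma ue_gen_ind (P : U -> Prop) :
  linear_stable P -> P 1 -> (forall x a, P a -> P (ue_gen x * a)) ->
  forall a, P a.
Proof.
move=> PL P1 Pg a; rewrite -[a]mulr1; move: a 1 P1.
apply: ue_ind => [x b Pb|b Pb|c a a' IH IH' b Pb|a a' IH IH' b Pb].
- exact: Pg.
- by rewrite mul1r.
- by rewrite mulrDl -scalerAl; apply: PL; [apply: IH|apply: IH'].
- by rewrite -mulrA; apply/IH/IH'.
Qed.

Definition ue_word (s : seq g) : U := \prod_(x <- s) ue_gen x.

Lemma ue_word_cons x s : ue_word (x :: s) = ue_gen x * ue_word s.
Proof. exact: big_cons. Qed.

Lemma ue_word_nil : ue_word [::] = 1.
Proof. exact: big_nil. Qed.

Lemma ue_word_ind (P : U -> Prop) :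
  linear_stable P -> (forall s, P (ue_word s)) -> forall a, P a.
Proof.
move=> PL Pw a.
suff /(_ [::]) : forall s, P (ue_word s * a) by rewrite ue_word_nil mul1r.
elim/ue_gen_ind: a => [c a b IHa IHb s||x a IH s].
- by rewrite mulrDr -scalerAr; apply: PL.
- by move=> s; rewrite mulr1.
- rewrite mulrA; have <- : ue_word (rcons s x) = ue_word s * ue_gen x.
    by rewrite /ue_word -cats1 big_cat big_seq1.
  exact: IH.
Qed.

(** The tensor a (x) b seen in the algebra [ue_tensor g]; fixing the type makes
    the ring and module structures found by rewriting agree. *)
Definition ue_tens (a b : U) : ue_tensor g := tens a b.

Lemma ue_tens_linearl b : linear (ue_tens^~ b).
Proof. exact: tens_linearl. Qed.
Lemma ue_tens_linearr a : linear (ue_tens a).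
Proof. exact: tens_linearr. Qed.
Lemma ue_tensDl a a' b : ue_tens (a + a') b = ue_tens a b + ue_tens a' b.
Proof. by have [_ -> _] := linear_morph (ue_tens_linearl b). Qed.
Lemma ue_tensDr a b b' : ue_tens a (b + b') = ue_tens a b + ue_tens a b'.
Proof. by have [_ -> _] := linear_morph (ue_tens_linearr a). Qed.
Lemma ue_tensM a b a' b' : ue_tens a b * ue_tens a' b' =
  ue_tens (a * a') (b * b').
Proof. exact: tensM. Qed.

Lemma ue_tens_sum (s : seq (U * U)) :
  \sum_(p <- s) tens p.1 p.2 = \sum_(p <- s) ue_tens p.1 p.2 :> ue_tensor g.
Proof. by []. Qed.

Lemma ue_tens_ind (P : ue_tensor g -> Prop) :
  linear_stable P -> (forall a b, P (ue_tens a b)) -> forall t, P t.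
Proof.
move=> PL Pt t; have [s ->] := tens_span t; rewrite ue_tens_sum.
elim: s => [|p s IH].
  by rewrite big_nil; apply: linear_stable0 PL (Pt 0 0).
by rewrite big_cons -[ue_tens _ _]scale1r; apply: PL.
Qed.

Lemma coproduct_prim x :
  coproduct (ue_gen x) = ue_tens (ue_gen x) 1 + ue_tens 1 (ue_gen x).
Proof. exact: coproduct_gen. Qed.
Lemma coproduct1 : coproduct 1 = ue_tens 1 1.
Proof. exact: rmorph1. Qed.

(** The coproduct of a word is the sum over all ways of distributing its letters
    among two words; what matters is that, apart from the two extreme terms,
    both factors are shorter and nonempty. *)
Lemma coproduct_word s : s != [::] ->
  exists r : seq (seq g * seq g),
    (forall p, p \in r -> [/\ p.1 != [::], p.2 != [::],
       (size p.1 < size s)%N & (size p.2 < size s)%N]) /\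
    coproduct (ue_word s) = ue_tens (ue_word s) 1 + ue_tens 1 (ue_word s)
      + \sum_(p <- r) ue_tens (ue_word p.1) (ue_word p.2).
Proof.
elim: s => // x s IHs _.
have [s0|s_neq0] := eqVneq s [::].
  exists [::]; split=> //.
  by rewrite s0 ue_word_cons ue_word_nil mulr1 coproduct_prim big_nil addr0.
have [r [szr Dr]] := IHs s_neq0.
exists ([:: (s, [:: x]); ([:: x], s)]
  ++ [seq (x :: p.1, p.2) | p <- r] ++ [seq (p.1, x :: p.2) | p <- r]).
have s_gt0 : (0 < size s)%N by rewrite lt0n size_eq0.
split=> [p|].
  rewrite !mem_cat !inE => /or3P[/orP[]/eqP-> //| |] /mapP[q /szr[]] ? ? ? ? ->
    /=.
    by split=> //; apply: ltnW.
  by split=> //; apply: ltnW.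
rewrite !big_cons big_cat !big_map /= !ue_word_cons ue_word_nil mulr1.
rewrite rmorphM /= coproduct_prim Dr !(mulrDl, mulrDr) !mulr_sumr !ue_tensM.
have -> : \sum_(p <- r)
      ue_tens (ue_gen x) 1 * ue_tens (ue_word p.1) (ue_word p.2)
    = \sum_(p <- r) ue_tens (ue_word (x :: p.1)) (ue_word p.2).
  by apply: eq_bigr => p _; rewrite ue_tensM mul1r ue_word_cons.
have -> : \sum_(p <- r)
      ue_tens 1 (ue_gen x) * ue_tens (ue_word p.1) (ue_word p.2)
    = \sum_(p <- r) ue_tens (ue_word p.1) (ue_word (x :: p.2)).
  by apply: eq_bigr => p _; rewrite ue_tensM mul1r ue_word_cons.
have regroup (V : zmodType) (a b c d e f : V) :
    a + b + e + (c + d + f) = a + d + (c + (b + (e + f))) by abelian.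
by rewrite !mul1r !mulr1; apply: regroup.
Qed.

End Words.

(** * Matched pairs of Lie algebras *)

(** These are the conditions under which m + h is a Lie algebra containing m and
    h as subalgebras, with [x, y] = L x y + R x y for x in m and y in h. *)
Record matched_pair (k : fieldType) (m h : lieType k)
    (L : m -> h -> h) (R : m -> h -> m) : Prop := MatchedPair {
  mp_L_linearl : forall y, linear (L^~ y);
  mp_L_linearr : forall x, linear (L x);
  mp_R_linearl : forall y, linear (R^~ y);
  mp_R_linearr : forall x, linear (R x);
  mp_L_lier : forall x y z,
    L x (lie y z) = lie (L x y) z + lie y (L x z) + (L (R x y) z - L (R x z) y);
  mp_R_lier : forall x y z, R x (lie y z) = R (R x y) z - R (R x z) y;
  mp_L_liel : forall x x' y, L (lie x x') y = L x (L x' y) - L x' (L x y);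
  mp_R_liel : forall x x' y, R (lie x x') y =
    lie (R x y) x' + lie x (R x' y) + (R x (L x' y) - R x' (L x y))
}.

Section MatchedPair.
Variables (k : fieldType) (m h : lieType k).
Variables (L : m -> h -> h) (R : m -> h -> m).
Hypothesis mpP : matched_pair L R.
Let L_linearl := mp_L_linearl mpP.
Let L_linearr := mp_L_linearr mpP.
Let R_linearl := mp_R_linearl mpP.
Let R_linearr := mp_R_linearr mpP.
Let L_lier := mp_L_lier mpP.
Let R_lier := mp_R_lier mpP.
Let L_liel := mp_L_liel mpP.
Let R_liel := mp_R_liel mpP.
Local Notation U := (enveloping h).

(* A pair (u, f) stands for u together with the action x |-> f x of m on u. *)
Local Notation N := (U * (m -> U))%type.
Let S (p : N) : Prop := linear p.2.
Let act (y : h) (p : N) : N :=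
  (ue_gen y * p.1,
   fun x => ue_gen y * p.2 x + ue_gen (L x y) * p.1 + p.2 (R x y)).

Let N_lin c (p q : N) x : (c *: p + q).2 x = c *: p.2 x + q.2 x.
Proof. by []. Qed.
Let N_sub (p q : N) x : (p - q).2 x = p.2 x - q.2 x.
Proof. by []. Qed.
Let act2 y (p : N) x :
  (act y p).2 x = ue_gen y * p.2 x + ue_gen (L x y) * p.1 + p.2 (R x y).
Proof. by []. Qed.
Let N_eq (p q : N) : p.1 = q.1 -> p.2 =1 q.2 -> p = q.
Proof. by case: p q => [a f] [b f'] /= -> /funext->. Qed.

Let S0 : S 0.
Proof. by move=> c x y; rewrite scaler0 addr0. Qed.

Let S_linear c p q : S p -> S q -> S (c *: p + q).
Proof.
move=> Sp Sq d x y; rewrite !N_lin Sp Sq.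
by rewrite !scalerDr !scalerA [d * c]mulrC; abelian.
Qed.

Let S_act y p : S p -> S (act y p).
Proof.
move=> Sp c x x'; rewrite !act2 Sp L_linearl R_linearl linearP Sp.
by rewrite mulrDr mulrDl -scalerAr -scalerAl !scalerDr; abelian.
Qed.

Let act_linearl p : S p -> linear (act^~ p).
Proof.
move=> Sp c y y'; apply: N_eq => [|x].
  by rewrite /= linearP mulrDl scalerAl.
rewrite N_lin !act2 L_linearr R_linearr !linearP Sp /=.
by rewrite !mulrDl -!scalerAl !scalerDr; abelian.
Qed.

Let act_linearr y : linear (act y).
Proof.
move=> c p q; apply: N_eq => [|x]; first by rewrite /= mulrDr -scalerAr.
by rewrite N_lin !act2 !N_lin /= !mulrDr -!scalerAr !scalerDr; abelian.
Qed.

Let act_lie y z p : S p -> act (lie y z) p = act y (act z p) - act z (act y p).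
Proof.
move=> /linear_morph[_ pD pZ]; have pN x : p.2 (- x) = - p.2 x.
  by rewrite -scaleN1r pZ scaleN1r.
apply: N_eq => [|x]; first by rewrite /= ue_gen_lie mulrBl !mulrA.
rewrite N_sub !act2 L_lier R_lier pD pN !(raddfD, raddfN) /= !ue_gen_lie.
rewrite !(mulrDl, mulrDr, mulNr, mulrN) !mulrA.
abelian.
Qed.

Let actP : lie_action S act := LieAction S0 S_linear S_act act_linearl
  act_linearr act_lie.

(** The action of m on U(h), that is, on the module over the Lie algebra m + h
    induced from the trivial m-module. *)
Definition mp_act (x : m) (a : U) : U := (ue_act act a (1, 0)).2 x.

Let S10 : S (1, 0).
Proof. by move=> c x y; rewrite scaler0 addr0. Qed.

Let act_fst a : (ue_act act a (1, 0)).1 = a.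
Proof.
elim/ue_gen_ind: a => [c a b IHa IHb||x a IH].
- by rewrite (ue_act_linearl actP S10) /= IHa IHb.
- by rewrite (ue_act1 actP S10).
- rewrite (ue_actM actP _ _ S10).
  rewrite (ue_act_gen actP) /= ?IH //.
  exact: (ue_act_stable actP _ S10).
Qed.

Lemma mp_act_linearl a : linear (mp_act^~ a).
Proof. exact: (ue_act_stable actP a S10). Qed.

Lemma mp_act_linearr x : linear (mp_act x).
Proof.
move=> c a b; rewrite /mp_act.
by rewrite (ue_act_linearl actP S10).
Qed.

Lemma mp_act1 x : mp_act x 1 = 0.
Proof.
by rewrite /mp_act (ue_act1 actP S10).
Qed.

Lemma mp_act_genM x y a : mp_act x (ue_gen y * a) =
  ue_gen y * mp_act x a + ue_gen (L x y) * a + mp_act (R x y) a.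
Proof.
rewrite /mp_act (ue_actM actP _ _ S10).
rewrite (ue_act_gen actP); last exact: (ue_act_stable actP _ S10).
by rewrite act2 act_fst.
Qed.

(** Both sides vanish on 1, and the matched pair axioms make them satisfy the
    same commutation rule with left multiplication by y. *)
Lemma mp_act_lie x x' a :
  mp_act (lie x x') a = mp_act x (mp_act x' a) - mp_act x' (mp_act x a).
Proof.
have Dl a' := linear_morph (mp_act_linearl a').
have DlD a' z z' : mp_act (z + z') a' = mp_act z a' + mp_act z' a'
  by have [] := Dl a'.
have DlN a' z : mp_act (- z) a' = - mp_act z a'.
  by rewrite -scaleN1r; have [_ _ ->] := Dl a'; rewrite scaleN1r.
have DrD z a' b' : mp_act z (a' + b') = mp_act z a' + mp_act z b'.
  by have [] := linear_morph (mp_act_linearr z).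
elim/ue_gen_ind: a x x' => [c a b IHa IHb x x'|x x'|y a IH x x'].
- rewrite !mp_act_linearr IHa IHb scalerBr; abelian.
- have Dr0 z : mp_act z 0 = 0 by have [] := linear_morph (mp_act_linearr z).
  by rewrite !mp_act1 !Dr0 subr0.
- rewrite !(mp_act_genM, DrD) L_liel R_liel !(DlD, DlN) !IH.
  rewrite linearB /= !(mulrBl, mulrBr); abelian.
Qed.

End MatchedPair.

(** * The composition Lie algebra of a post-Lie algebra *)

Section PostLieRules.
Variables (k : fieldType) (g : postLieType k).
Implicit Types x y z : g.

Lemma lieDl x y z : lie (x + y) z = lie x z + lie y z.
Proof. by have [] := linear_morph (lie_linearl z). Qed.
Lemma lieDr x y z : lie x (y + z) = lie x y + lie x z.
Proof. by have [] := linear_morph (lie_linearr x). Qed.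
Lemma triDl x y z : tri (x + y) z = tri x z + tri y z.
Proof. by have [] := linear_morph (tri_linearl z). Qed.
Lemma triDr x y z : tri x (y + z) = tri x y + tri x z.
Proof. by have [] := linear_morph (tri_linearr x). Qed.
Lemma lieNl x y : lie (- x) y = - lie x y.
Proof.
by have [_ _ lZ] := linear_morph (lie_linearl y); rewrite -!scaleN1r lZ.
Qed.
Lemma lieNr x y : lie x (- y) = - lie x y.
Proof.
by have [_ _ lZ] := linear_morph (lie_linearr x); rewrite -!scaleN1r lZ.
Qed.
Lemma triNl x y : tri (- x) y = - tri x y.
Proof.
by have [_ _ lZ] := linear_morph (tri_linearl y); rewrite -!scaleN1r lZ.
Qed.
Lemma triNr x y : tri x (- y) = - tri x y.
Proof.
by have [_ _ lZ] := linear_morph (tri_linearr x); rewrite -!scaleN1r lZ.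
Qed.

Lemma lieC x y : lie x y = - lie y x.
Proof.
apply/eqP; rewrite -subr_eq0 opprK; apply/eqP.
by have := liexx (x + y); rewrite !(lieDl, lieDr) !liexx add0r addr0.
Qed.

Lemma lie_leibniz x y z : lie x (lie y z) = lie (lie x y) z + lie y (lie x z).
Proof.
apply/eqP; rewrite -subr_eq0; apply/eqP; rewrite -(lie_jacobi x y z).
rewrite [lie z (lie x y)]lieC [lie z x]lieC lieNr; abelian.
Qed.

Definition post_lieE := (lieDl, lieDr, lieNl, lieNr, triDl, triDr, triNl,
  triNr).

Definition compo_lie x y : g := tri x y - tri y x + lie x y.

Lemma tri_compo_liel x y z :
  tri (compo_lie x y) z = tri x (tri y z) - tri y (tri x z).
Proof. by rewrite !post_lieE tri_liel /associator; abelian. Qed.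

Lemma compo_lie_linearl y : linear (compo_lie^~ y).
Proof.
by move=> c x x'; rewrite /compo_lie tri_linearl tri_linearr lie_linearl
  !scalerDr scalerN; abelian.
Qed.
Lemma compo_liexx x : compo_lie x x = 0.
Proof. by rewrite /compo_lie liexx subrr addr0. Qed.
Lemma compo_lieC x y : compo_lie x y = - compo_lie y x.
Proof. by rewrite /compo_lie lieC; abelian. Qed.
Lemma compo_lie_linearr x : linear (compo_lie x).
Proof.
move=> c y y'; rewrite compo_lieC compo_lie_linearl opprD -scalerN.
by rewrite -!compo_lieC.
Qed.

Lemma compo_lie_jacobi x y z :
  compo_lie x (compo_lie y z) + compo_lie y (compo_lie z x)
    + compo_lie z (compo_lie x y) = 0.
Proof.
rewrite -(lie_jacobi x y z) {1 3 5}/compo_lie !tri_compo_liel /compo_lie.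
rewrite !(post_lieE, tri_lier).
rewrite ![lie (tri _ _) _]lieC; abelian.
Qed.

(** The right action of the composition Lie algebra on itself that, together
    with the left action |>, forms a matched pair. *)
Definition compo_ract x y : g := lie x y - tri y x.

Lemma compo_ract_linearl y : linear (compo_ract^~ y).
Proof.
by move=> c x x'; rewrite /compo_ract lie_linearl tri_linearr scalerBr; abelian.
Qed.
Lemma compo_ract_linearr x : linear (compo_ract x).
Proof.
by move=> c y y'; rewrite /compo_ract lie_linearr tri_linearl scalerBr; abelian.
Qed.

Lemma tri_compo_lier x y z : tri x (compo_lie y z) =
  compo_lie (tri x y) z + compo_lie y (tri x z)
    + (tri (compo_ract x y) z - tri (compo_ract x z) y).
Proof.
rewrite /compo_lie /compo_ract !(post_lieE, tri_lier, tri_liel) /associator.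
abelian.
Qed.

Lemma compo_ract_lier x y z : compo_ract x (compo_lie y z) =
  compo_ract (compo_ract x y) z - compo_ract (compo_ract x z) y.
Proof.
rewrite /compo_ract tri_compo_liel /compo_lie !(post_lieE, tri_lier).
rewrite (lie_leibniz x y z) [lie y (lie x z)]lieC ![lie (tri _ _) _]lieC.
abelian.
Qed.

Lemma compo_ract_liel x x' y : compo_ract (compo_lie x x') y =
  compo_lie (compo_ract x y) x' + compo_lie x (compo_ract x' y)
    + (compo_ract x (tri x' y) - compo_ract x' (tri x y)).
Proof.
rewrite /compo_ract /compo_lie !(post_lieE, tri_lier, tri_liel) /associator.
rewrite (lie_leibniz x x' y) [lie x' (lie x y)]lieC ![lie (tri _ _) _]lieC.
abelian.
Qed.

End PostLieRules.

(** A copy of g, to carry the composition bracket. *)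
Definition compo (k : fieldType) (g : postLieType k) : Type := g.

HB.instance Definition _ (k : fieldType) (g : postLieType k) :=
  GRing.Lmodule.on (compo g).
HB.instance Definition _ (k : fieldType) (g : postLieType k) :=
  Lmodule_isLie.Build k (compo g)
    (@compo_lie_linearl k g) (@compo_lie_linearr k g)
    (@compo_liexx k g) (@compo_lie_jacobi k g).

(** * Construction of the extended product *)

Section BarConstruction.
Variables (k : fieldType) (g : postLieType k).
Local Notation U := (enveloping g).
Local Notation gbar := (compo g).
Local Notation V := (enveloping gbar).

Let L (x : gbar) (y : g) : g := tri (x : g) y.
Let R (x : gbar) (y : g) : gbar := 0.
Let Lbar (x y : gbar) : gbar := tri (x : g) (y : g).
Let Rbar (x y : gbar) : gbar := compo_ract (x : g) (y : g).

Let der_matched_pair : matched_pair L R.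
Proof.
have tri0 (t : g) : L 0 t = 0 by have [] := linear_morph (@tri_linearl k g t).
have lie0l (t : gbar) : lie 0 t = 0 by have [] := linear_morph (lie_linearl t).
have lie0r (t : gbar) : lie t 0 = 0 by have [] := linear_morph (lie_linearr t).
split=> [y|x|y|x|x y z|x y z|x x' y|x x' y].
- exact: tri_linearl.
- exact: tri_linearr.
- by move=> c x x'; rewrite scaler0 addr0.
- by move=> c y y'; rewrite scaler0 addr0.
- by rewrite !tri0 subrr addr0; exact: tri_lier.
- by rewrite /R subrr.
- exact: tri_compo_liel.
- by rewrite /R lie0l lie0r subrr !addr0.
Qed.

Let bar_matched_pair : matched_pair Lbar Rbar.
Proof.
split=> [y|x|y|x|x y z|x y z|x x' y|x x' y].
- exact: tri_linearl.
- exact: tri_linearr.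
- exact: compo_ract_linearl.
- exact: compo_ract_linearr.
- exact: tri_compo_lier.
- exact: compo_ract_lier.
- exact: tri_compo_liel.
- exact: compo_ract_liel.
Qed.

(** Extends y |-> x |> y to a derivation of U(g): the right action R being zero,
    the commutation rule of [mp_act] is the Leibniz rule. *)
Definition der (x : g) (A : U) : U := mp_act L R x A.

Lemma der_linearl A : linear (der^~ A).
Proof. exact: (mp_act_linearl der_matched_pair). Qed.
Lemma der_linearr x : linear (der x).
Proof. exact: (mp_act_linearr der_matched_pair). Qed.
Lemma der1 x : der x 1 = 0.
Proof. exact: (mp_act1 der_matched_pair). Qed.
Lemma der_genM x y A :
  der x (ue_gen y * A) = ue_gen y * der x A + ue_gen (tri x y) * A.
Proof.
rewrite /der (mp_act_genM der_matched_pair); rewrite -[RHS]addr0; congr (_ + _).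
by have [] := linear_morph (der_linearl A).
Qed.
Lemma der_gen x y : der x (ue_gen y) = ue_gen (tri x y).
Proof. by rewrite -[ue_gen y]mulr1 der_genM der1 mulr0 add0r mulr1. Qed.
Lemma derM x A B : der x (A * B) = der x A * B + A * der x B.
Proof.
elim/ue_gen_ind: A => [c A A' IH IH'||y A IH].
- by rewrite mulrDl -scalerAl !der_linearr IH IH' !mulrDl -!scalerAl scalerDr;
  abelian.
- by rewrite der1 mul1r mul0r add0r mul1r.
- by rewrite -mulrA !der_genM IH !(mulrDl, mulrDr) !mulrA; abelian.
Qed.
Lemma der_compo_lie x y A :
  der (compo_lie x y) A = der x (der y A) - der y (der x A).
Proof. exact: (mp_act_lie der_matched_pair). Qed.

Let gen (x : g) : V := ue_gen (x : gbar).
Definition bar_der (x : g) (u : V) : V := mp_act Lbar Rbar x u.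

Let bar_der_linearl u : linear (bar_der^~ u).
Proof. exact: (mp_act_linearl bar_matched_pair). Qed.
Let bar_der_linearr x : linear (bar_der x).
Proof. exact: (mp_act_linearr bar_matched_pair). Qed.
Let bar_der1 x : bar_der x 1 = 0.
Proof. exact: (mp_act1 bar_matched_pair). Qed.
Let bar_der_genM x y u : bar_der x (gen y * u) =
  gen y * bar_der x u + gen (tri x y) * u + bar_der (compo_ract x y) u.
Proof. exact: (mp_act_genM bar_matched_pair). Qed.
Let bar_der_compo_lie x y u :
  bar_der (compo_lie x y) u = bar_der x (bar_der y u) - bar_der y (bar_der x u).
Proof. exact: (mp_act_lie bar_matched_pair). Qed.
Let gen_compo_lie x y : gen (compo_lie x y) = gen x * gen y - gen y * gen x.
Proof. exact: ue_gen_lie. Qed.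
Let genD x y : gen (x + y) = gen x + gen y.
Proof. exact: raddfD. Qed.
Let genN x : gen (- x) = - gen x.
Proof. exact: raddfN. Qed.
Let gen_linear : linear gen.
Proof. exact: (@ue_gen_linear k gbar). Qed.
Let bar_derD x y u : bar_der (x + y) u = bar_der x u + bar_der y u.
Proof. by have [] := linear_morph (bar_der_linearl u). Qed.
Let bar_derN x u : bar_der (- x) u = - bar_der x u.
Proof.
by have [_ _ dZ] := linear_morph (bar_der_linearl u); rewrite -!scaleN1r dZ.
Qed.
Let bar_derDr x u v : bar_der x (u + v) = bar_der x u + bar_der x v.
Proof. by have [] := linear_morph (bar_der_linearr x). Qed.
Let bar_derNr x u : bar_der x (- u) = - bar_der x u.
Proof.
by have [_ _ dZ] := linear_morph (bar_der_linearr x); rewrite -!scaleN1r dZ.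
Qed.

(** Left multiplication by x in U(g), transported to U(gbar): since x * A stands
    for xA + d_x A, one has xA = x * A - d_x A. *)
Definition bar_mul (x : g) (u : V) : V := gen x * u - bar_der x u.

Let bar_mulP : lie_action (fun=> True) bar_mul.
Proof.
split=> // [u _ c x y|x c u v|x y u _]; rewrite /bar_mul.
- by rewrite gen_linear bar_der_linearl mulrDl -scalerAl scalerBr; abelian.
- by rewrite bar_der_linearr mulrDr -scalerAr scalerBr; abelian.
- have -> : lie x y = compo_lie x y + tri y x - tri x y
    by rewrite /compo_lie; abelian.
  rewrite !(bar_derDr, bar_derNr, mulrBr, bar_der_genM).
  rewrite /compo_ract !(gen_compo_lie, bar_der_compo_lie, genD, genN, bar_derD,
    bar_derN).
  rewrite [lie y x]lieC bar_derN !(mulrDl, mulrDr, mulNr, mulrN) !mulrA.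
  have -> : bar_der (lie x y) u =
      bar_der x (bar_der y u) - bar_der y (bar_der x u)
      + bar_der (tri y x) u - bar_der (tri x y) u.
    by rewrite -bar_der_compo_lie -!(bar_derN, bar_derD); congr bar_der;
      rewrite /compo_lie; abelian.
  abelian.
Qed.

(** The map Psi from U(g) to U(gbar). *)
Definition to_bar (A : U) : V := ue_act bar_mul A 1.

Lemma to_bar_linear : linear to_bar.
Proof. exact: (ue_act_linearl bar_mulP). Qed.
Lemma to_bar1 : to_bar 1 = 1.
Proof. exact: (ue_act1 bar_mulP). Qed.
Lemma to_bar_genM x A : to_bar (ue_gen x * A) = bar_mul x (to_bar A).
Proof. by rewrite /to_bar (ue_actM bar_mulP) // (ue_act_gen bar_mulP). Qed.

(** Psi intertwines d_x and dbar_x: both vanish on 1, and the commutator of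
    either with the action of y in g is the action of x |> y. *)
Lemma to_bar_der x A : to_bar (der x A) = bar_der x (to_bar A).
Proof.
elim/ue_gen_ind: A => [c A B IHA IHB||y A IH].
- by rewrite der_linearr !to_bar_linear IHA IHB bar_der_linearr.
- rewrite der1 to_bar1 bar_der1; by have [] := linear_morph to_bar_linear.
- rewrite der_genM; have [_ -> _] := linear_morph to_bar_linear.
  rewrite !to_bar_genM IH /bar_mul !(bar_derDr, bar_derNr, bar_der_genM).
  have -> : compo_ract x y = compo_lie x y - tri x y
    by rewrite /compo_ract /compo_lie; abelian.
  by rewrite bar_derD bar_derN bar_der_compo_lie; abelian.
Qed.

Let derP : lie_action (g := gbar) (fun=> True) der.
Proof.
split=> // [A _|x|x y A _]; [exact: der_linearl|exact: der_linearr|].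
exact: der_compo_lie.
Qed.

Definition ue_tri (A B : U) : U := ue_act (g := gbar) der (to_bar A) B.

Lemma ue_tri_linearl B : linear (ue_tri^~ B).
Proof.
by move=> c A A'; rewrite /ue_tri to_bar_linear (ue_act_linearl derP).
Qed.
Lemma ue_tri_linearr A : linear (ue_tri A).
Proof. exact: (ue_act_linear derP). Qed.
Lemma ue_tri1 A : ue_tri 1 A = A.
Proof. by rewrite /ue_tri to_bar1 (ue_act1 derP). Qed.
Lemma ue_tri_genM x A B :
  ue_tri (ue_gen x * A) B = der x (ue_tri A B) - ue_tri (der x A) B.
Proof.
rewrite /ue_tri to_bar_genM /bar_mul to_bar_der.
have actL : linear (ue_act (g := gbar) der ^~ B) :=
  ue_act_linearl derP I.
have [_ aD aZ] := linear_morph actL.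
by rewrite aD -scaleN1r aZ scaleN1r (ue_actM derP) // (ue_act_gen derP).
Qed.
Lemma ue_tri_gen x B : ue_tri (ue_gen x) B = der x B.
Proof.
rewrite -[ue_gen x]mulr1 ue_tri_genM ue_tri1 der1.
by have [-> _ _] := linear_morph (ue_tri_linearl B); rewrite subr0.
Qed.

End BarConstruction.

(** * The product rule *)

Section ProductRule.
Variables (k : fieldType) (g : postLieType k).
Local Notation U := (enveloping g).

(** Left multiplication by x for the product x * A = xA + x |> A, under which
    ue_tri is an action (see ue_tri_shift). *)
Definition shift (x : g) (A : U) : U := ue_gen x * A + der x A.

Lemma shift_linear x : linear (shift x).
Proof.
by move=> c A B; rewrite /shift der_linearr mulrDr -scalerAr scalerDr; abelian.
Qed.

(** The derivation d_x maps a word to a sum of words of the same length. *)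
Lemma der_word_closed (P : U -> Prop) x s :
  linear_stable P -> (forall s', size s' = size s -> P (ue_word s')) ->
  P (der x (ue_word s)).
Proof.
elim: s P => [|y s IH] P PL Pw.
  rewrite ue_word_nil der1; apply: (@linear_stable0 _ _ P 1 PL).
  by rewrite -(ue_word_nil g); apply: Pw.
rewrite ue_word_cons der_genM -[ue_gen y * _]scale1r; apply: (PL).
  apply: (IH (fun A => P (ue_gen y * A))) => [c A B PA PB|s' ss'].
    by rewrite mulrDr -scalerAr; apply: PL.
  by rewrite -ue_word_cons; apply: Pw; rewrite /= ss'.
by rewrite -ue_word_cons; apply: Pw.
Qed.

(** Up to a combination of words of the same length as s, the word x s is
    [shift x] of s, so words are reached by induction on their length. *)
Lemma shift_ind (P : U -> Prop) :
  linear_stable P -> P 1 -> (forall x A, P A -> P (shift x A)) -> forall A, P A.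
Proof.
move=> PL P1 Pshift; apply: ue_word_ind => // s; have [n] := ubnP (size s).
elim: n s => // n IH [_|x s /= /ltnSE size_s]; first by rewrite ue_word_nil.
have -> : ue_word (x :: s) = -1 *: der x (ue_word s) + shift x (ue_word s).
  by rewrite ue_word_cons scaleN1r /shift; abelian.
apply: (PL); last exact/Pshift/IH.
by apply: der_word_closed => // s' ss'; apply: IH; rewrite ss'.
Qed.

Section Coderivation.
Variable f : U -> U.
Hypothesis f_linear : linear f.

(** The map f (x) 1 + 1 (x) f. *)
Definition coder (t : ue_tensor g) : ue_tensor g :=
  tens_lift (fun u v => ue_tens (f u) v + ue_tens u (f v)) t.

Let coder_l v : linear (fun u => ue_tens (f u) v + ue_tens u (f v)).
Proof.
by move=> c u u'; rewrite f_linear !ue_tens_linearl scalerDr; abelian.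
Qed.
Let coder_r u : linear (fun v => ue_tens (f u) v + ue_tens u (f v)).
Proof.
by move=> c v v'; rewrite f_linear !ue_tens_linearr scalerDr; abelian.
Qed.

Lemma coder_linear : linear coder.
Proof. exact: tens_lift_linear coder_l coder_r. Qed.
Lemma coderE u v : coder (ue_tens u v) = ue_tens (f u) v + ue_tens u (f v).
Proof. exact: tens_liftE coder_l coder_r u v. Qed.
End Coderivation.

Lemma coproduct_der x A : coproduct (der x A) = coder (der x) (coproduct A).
Proof.
have cL := coder_linear (der_linearr x).
elim/ue_gen_ind: A => [||y A IH].
- by apply: linear_eq_stable => c A B; rewrite ?der_linearr !linearP /= ?cL.
- rewrite der1 linear0 coproduct1 (coderE (der_linearr x)) der1.
  have [-> _ _] := linear_morph (ue_tens_linearl (1 : U)).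
  by have [-> _ _] := linear_morph (ue_tens_linearr (1 : U)); rewrite addr0.
rewrite der_genM linearD !rmorphM /= IH !coproduct_prim.
elim/ue_tens_ind: (coproduct A) => [c t t' IHt IHt'|u v].
  by rewrite cL !mulrDr -!scalerAr cL -IHt -IHt' !scalerDr; abelian.
have [_ cD _] := linear_morph cL.
rewrite !(coderE (der_linearr x)) !mulrDl !mulrDr !ue_tensM !mul1r cD.
by rewrite !(coderE (der_linearr x)) !der_genM !(ue_tensDl, ue_tensDr); abelian.
Qed.

(** A derivation that extends a map from g to g is a coderivation, and so is
    left multiplication by a primitive element; hence their sum is one. *)
Lemma coproduct_shift x A : coproduct (shift x A) =
  coder (shift x) (coproduct A).
Proof.
rewrite /shift linearD rmorphM /= coproduct_der coproduct_prim.
have cL := coder_linear (der_linearr x).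
have sL := coder_linear (shift_linear x).
elim/ue_tens_ind: (coproduct A) => [c t t' IHt IHt'|u v].
  by rewrite cL sL mulrDr -scalerAr -IHt -IHt' scalerDr; abelian.
rewrite (coderE (der_linearr x)) (coderE (shift_linear x)) mulrDl !ue_tensM
  !mul1r.
by rewrite /shift ue_tensDl ue_tensDr; abelian.
Qed.

(** The right-hand side of the product rule, as a linear function of the
    coproduct t of A. *)
Definition tri_mul (B C : U) (t : ue_tensor g) : U :=
  tens_lift (fun u v : U => ue_tri u B * ue_tri v C) t.

Let tri_mul_l B C v : linear (fun u : U => ue_tri u B * ue_tri v C).
Proof. by move=> c u u'; rewrite ue_tri_linearl mulrDl scalerAl. Qed.
Let tri_mul_r B C u : linear (fun v : U => ue_tri u B * ue_tri v C).
Proof. by move=> c v v'; rewrite ue_tri_linearl mulrDr scalerAr. Qed.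

Lemma tri_mul_linear B C : linear (tri_mul B C).
Proof. exact: tens_lift_linear (tri_mul_l B C) (tri_mul_r B C). Qed.
Lemma tri_mulE B C u v : tri_mul B C (ue_tens u v) = ue_tri u B * ue_tri v C.
Proof. exact: tens_liftE (tri_mul_l B C) (tri_mul_r B C) u v. Qed.

Lemma ue_tri_shift x A B : ue_tri (shift x A) B = der x (ue_tri A B).
Proof.
by rewrite /shift; have [_ -> _] := linear_morph (ue_tri_linearl B);
  rewrite ue_tri_genM subrK.
Qed.

Lemma tri_mul_shift B C x t :
  tri_mul B C (coder (shift x) t) = der x (tri_mul B C t).
Proof.
have cL := coder_linear (shift_linear x); have tL := tri_mul_linear B C.
elim/ue_tens_ind: t => [c t t' IHt IHt'|u v].
  by rewrite cL !tL der_linearr IHt IHt'.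
have [_ tD _] := linear_morph tL.
by rewrite (coderE (shift_linear x)) tD !tri_mulE !ue_tri_shift derM.
Qed.

(** The property holds at 1 and passes from A to [shift x A], because [ue_tri]
    turns [shift x] into the derivation d_x. *)
Lemma ue_triM A B C : ue_tri A (B * C) = tri_mul B C (coproduct A).
Proof.
elim/shift_ind: A => [||x A IH].
- apply: linear_eq_stable => [|c A A']; first exact: ue_tri_linearl.
  by rewrite linearP tri_mul_linear.
- by rewrite coproduct1 tri_mulE !ue_tri1.
- by rewrite ue_tri_shift IH coproduct_shift tri_mul_shift.
Qed.

End ProductRule.

(** * Uniqueness *)

Section Uniqueness.
Variables (k : fieldType) (g : postLieType k).
Local Notation U := (enveloping g).

Definition post_lie_extension (T : U -> U -> U) : Prop :=
  (forall B, linear (T^~ B)) /\ (forall A, linear (T A)) /\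
  (forall x y : g, T (ue_gen x) (ue_gen y) = ue_gen (tri x y)) /\
  (forall A, T 1 A = A) /\
  (forall (x y : g) (A : U),
     T (ue_gen x * A) (ue_gen y) =
     T (ue_gen x) (T A (ue_gen y)) - T (T (ue_gen x) A) (ue_gen y)) /\
  (forall (A B C : U) (s : seq (U * U)),
     coproduct A = \sum_(p <- s) tens p.1 p.2 ->
     T A (B * C) = \sum_(p <- s) T p.1 B * T p.2 C).

Lemma ue_tri_extension : post_lie_extension (@ue_tri k g).
Proof.
split; first exact: ue_tri_linearl.
split; first exact: ue_tri_linearr.
split; first by move=> x y; rewrite ue_tri_gen der_gen.
split; first exact: ue_tri1.
split; first by move=> x y A; rewrite ue_tri_genM !ue_tri_gen.
move=> A B C s As; rewrite ue_triM As ue_tens_sum.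
have tL := tri_mul_linear B C; have [t0 tD _] := linear_morph tL.
elim: s {As} => [|p s IH]; first by rewrite !big_nil t0.
by rewrite !big_cons tD IH tri_mulE.
Qed.

Section ExtensionLaws.
Variable T : U -> U -> U.
Hypothesis T1 : forall A, T 1 A = A.
Hypothesis T_mul : forall (A B C : U) (s : seq (U * U)),
  coproduct A = \sum_(p <- s) tens p.1 p.2 ->
  T A (B * C) = \sum_(p <- s) T p.1 B * T p.2 C.

(** By induction on the length only the two extreme terms of the coproduct
    contribute to T w (1 * 1), so that T w 1 = T w 1 + T w 1. *)
Lemma extension_word1 s : s != [::] -> T (ue_word s) 1 = 0.
Proof.
have [n] := ubnP (size s); elim: n s => // n IH s /ltnSE size_s s_neq0.
have [r [szr Ds]] := coproduct_word s_neq0.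
pose w := [:: (ue_word s, 1); (1, ue_word s)]
  ++ [seq (ue_word p.1, ue_word p.2) | p <- r].
have Tw : T (ue_word s) (1 * 1) = \sum_(p <- w) T p.1 1 * T p.2 1.
  by apply: T_mul; rewrite Ds ue_tens_sum !big_cons big_map addrA.
move: Tw; rewrite !big_cons big_map big_seq big1 => [|p /szr[p1 p2 lt1 lt2]].
  rewrite !T1 !mulr1 mul1r addr0 => /eqP.
  by rewrite -[X in X == _]addr0 (inj_eq (addrI _)) eq_sym => /eqP.
by rewrite IH ?mul0r // (leq_trans lt1).
Qed.

Hypothesis T_gen : forall x y : g, T (ue_gen x) (ue_gen y) = ue_gen (tri x y).

Lemma extension_genM x B C : T (ue_gen x) (B * C) =
  T (ue_gen x) B * C + B * T (ue_gen x) C.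
Proof.
rewrite (@T_mul _ B C [:: (ue_gen x, 1); (1, ue_gen x)]).
  by rewrite !big_cons big_nil addr0 !T1.
by rewrite coproduct_prim ue_tens_sum !big_cons big_nil addr0.
Qed.

Lemma extension_gen1 x : T (ue_gen x) 1 = 0.
Proof.
have -> : ue_gen x = ue_word [:: x] by rewrite ue_word_cons ue_word_nil mulr1.
exact: extension_word1.
Qed.

Hypothesis T_linearr : forall A, linear (T A).

Lemma extension_gen x B : T (ue_gen x) B = der x B.
Proof.
elim/ue_gen_ind: B => [||y B IH].
- by apply: linear_eq_stable; [apply: T_linearr | apply: der_linearr].
- by rewrite extension_gen1 der1.
- by rewrite extension_genM T_gen IH der_genM addrC.
Qed.

End ExtensionLaws.

(** It suffices to compare the values at 1 and at generators, since the product
    rule then propagates the equality to B.  At 1 both vanish on nonempty words;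
    at a generator both satisfy T (shift x A) y = d_x (T A y). *)
Lemma post_lie_extension_uniq T : post_lie_extension T -> T =2 @ue_tri k g.
Proof.
move=> [Tl [Tr [Tg [T1 [TgM TM]]]]] A B.
have [_ [_ [_ [_ [_ tM]]]]] := ue_tri_extension.
have T_one C : T C 1 = ue_tri C 1.
  elim/ue_word_ind: C => [|s].
    by apply: linear_eq_stable; [apply: Tl | apply: ue_tri_linearl].
  have [->|s_neq0] := eqVneq s [::]; first by rewrite ue_word_nil T1 ue_tri1.
  rewrite (extension_word1 T1 TM s_neq0).
  by rewrite (extension_word1 (@ue_tri1 k g) tM s_neq0).
have T_gen C y : T C (ue_gen y) = ue_tri C (ue_gen y).
  elim/shift_ind: C => [||x C IH].
  - by apply: linear_eq_stable; [apply: Tl | apply: ue_tri_linearl].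
  - by rewrite T1 ue_tri1.
  - rewrite ue_tri_shift -IH /shift.
    have [_ -> _] := linear_morph (Tl (ue_gen y)).
    by rewrite TgM !(extension_gen T1 TM Tg Tr) subrK.
elim/ue_gen_ind: B A => [c B C IHB IHC A|A|y B IH A].
- by rewrite Tr ue_tri_linearr IHB IHC.
- exact: T_one.
- have [s As] := tens_span (coproduct A).
  rewrite (TM _ _ _ _ As) (tM _ _ _ _ As).
  by apply: eq_bigr => p _; rewrite T_gen IH.
Qed.

End Uniqueness.

Theorem proposition3p1 (k : fieldType) (k_char0 : [pchar k] =i pred0)
    (g : postLieType k) :
  exists! T : enveloping g -> enveloping g -> enveloping g,
    (forall B, linear (T^~ B)) /\ (forall A, linear (T A)) /\
    (forall x y : g, T (ue_gen x) (ue_gen y) = ue_gen (tri x y)) /\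
    (forall A, T 1 A = A) /\
    (forall (x y : g) (A : enveloping g),
       T (ue_gen x * A) (ue_gen y) =
       T (ue_gen x) (T A (ue_gen y)) - T (T (ue_gen x) A) (ue_gen y)) /\
    (forall (A B C : enveloping g) (s : seq (enveloping g * enveloping g)),
       coproduct A = \sum_(p <- s) tens p.1 p.2 ->
       T A (B * C) = \sum_(p <- s) T p.1 B * T p.2 C).
Proof.
exists (@ue_tri k g); split; first exact: ue_tri_extension.
move=> T /post_lie_extension_uniq T_eq.
by apply/funext => A; apply/funext => B.
Qed.
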